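(* Let $C$ be an extended linear code of length $d+1$ over $\mathbb{Z}_N$ and let $g=(g_{ji})$ be a generating matrix of $C$, with $m$ rows and with columns indexed by $i=0,\dots,d$. Put $\gcd_i=\gcd(g_{1i},\dots,g_{mi},N)$. If $C$ is thin and every $\gcd_i=1$ (in particular, if $N$ is prime), then $d\ge N$.
   Context: $\mathbb{Z}_N=\mathbb{Z}/N\mathbb{Z}$; its elements are identified with the representatives $0,1,\dots,N-1$, and gcd's are taken of these integers. A linear code of length $n$ over $\mathbb{Z}_N$ is a submodule $C\subseteq\mathbb{Z}_N^n$; its elements are called words; a generating matrix is a matrix whose rows generate $C$. $C$ is extended if every word has coordinate sum $0\bmod N$. An extended code is thin if it contains no word all of whose entries are nonzero.
   Formalization: N ≥ 2 is assumed (the claim fails for N = 1, d = 0), and the remark ''in particular, if N is prime'' is stated for generating matrices with no zero column, since with a zero column gcd_i = N and the zero code of length 1 is a counterexample. *)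

(* Defs.v *)
From HB Require Import structures.
From mathcomp Require Import all_boot all_order all_algebra.
Set Implicit Arguments.
Unset Strict Implicit.
Unset Printing Implicit Defensive.
Import GRing.Theory.
Local Open Scope ring_scope.

(* 'Z_N has N elements only when 1 < N, so every use of these notions must     *)
(* come with that hypothesis. An element of 'Z_N coerces to its representative *)
(* among 0, .., N - 1.                                                         *)

Definition linear_code (N n : nat) (C : {set 'rV['Z_N]_n}) : Prop :=
  submod_closed C.

(* u *m g is the linear combination of the rows of g with coefficients u. *)
Definition generating_matrix (N m n : nat)
    (g : 'M['Z_N]_(m, n)) (C : {set 'rV['Z_N]_n}) : Prop :=
  C = [set u *m g | u : 'rV['Z_N]_m].

Definition extended (N n : nat) (C : {set 'rV['Z_N]_n}) : Prop :=
  forall w, w \in C -> \sum_(i < n) w ord0 i = 0.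

Definition thin (N n : nat) (C : {set 'rV['Z_N]_n}) : Prop :=
  extended C /\ ~ exists2 w, w \in C & forall i, w ord0 i != 0.

Definition col_gcd (N m n : nat) (g : 'M['Z_N]_(m, n)) (i : 'I_n) : nat :=
  gcdn (\big[gcdn/0%N]_(j < m) (g j i : nat)) N.

(* Main.v *)
Require Import Defs.
From HB Require Import structures.
From mathcomp Require Import all_boot all_order all_algebra.
Import GRing.Theory.
Local Open Scope ring_scope.

(** When every [gcd_i] is 1, Bezout makes each coordinate map on the code onto
    [Z_N], so its kernel has density [1/N]. Thinness says that the [d + 1]
    kernels cover everything; as they all contain 0, the covering is not
    disjoint, so that [(d + 1) / N > 1]. *)

(** Each fibre is a translate of the kernel, so the [#|A|] fibres that partition [V] all have the
    same size. *)
Lemma card_kernel_onto (V A : finZmodType) (f : V -> A) :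
    {morph f : u v / u + v} -> (forall a, exists v, f v = a) ->
  (#|[set v | f v == 0%R]| * #|A| = #|V|)%N.
Proof.
move=> fD fonto.
have fiber a : #|[set v | f v == a]| = #|[set v | f v == 0]|.
  have [v0 fv0] := fonto a; rewrite -[RHS](card_imset _ (addrI v0)).
  apply: eq_card => v; rewrite inE; apply/eqP/imsetP => [fv | [u]].
    exists (v - v0); last by rewrite addrC subrK.
    by rewrite inE -(inj_eq (addIr a)) -{1}fv0 -fD subrK add0r fv.
  by rewrite inE => /eqP fu ->; rewrite fD fu addr0.
rewrite -[in RHS]sum1_card (partition_big f xpredT) //=.
under eq_bigr => a _ do rewrite sum1dep_card fiber.
by rewrite sum_nat_const mulnC.
Qed.

Lemma ltn_card_kernel_cover (V A : finZmodType) (n : nat) (f : 'I_n -> V -> A) :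
    (1 < #|A|)%N -> (forall i, {morph f i : u v / u + v}) ->
    (forall i a, exists v, f i v = a) -> (forall v, exists i, f i v = 0) ->
  (#|A| < n)%N.
Proof.
move=> A_gt1 fD fonto fcover.
pose K i := [set v | f i v == 0].
have cardK i : (#|K i| * #|A| = #|V|)%N by apply: card_kernel_onto.
have K0 i : 0 \in K i.
  by rewrite inE -(inj_eq (addIr (f i 0))) -fD !add0r.
have cardKD i : ((#|K i :\ 0%R| + 1) * #|A| = #|V|)%N.
  by rewrite -(cardK i) (cardsD1 0 (K i)) K0 addnC.
(* Union bound on nonzero vectors only: discarding the shared 0 first is what makes the final
   inequality strict. *)
have leV : (#|V| - 1 <= \sum_(i < n) #|K i :\ 0%R|)%N.
  apply: (@leq_trans #|\bigcup_(i < n) (K i :\ 0)|); last first.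
    apply: (big_ind2 (fun (B : {set V}) k => #|B| <= k)%N) => //.
      by rewrite cards0.
    move=> B k B' k' leB leB'.
    by apply: leq_trans (leq_card_setU B B') (leq_add leB leB').
  rewrite -cardsT (cardsD1 0 setT) inE addKn.
  apply/subset_leq_card/subsetP => v; rewrite !inE andbT => v_neq0.
  have [i fv] := fcover v.
  by apply/bigcupP; exists i; rewrite // !inE v_neq0 fv /=.
(* Covering 0 already forces [n] to be positive; the index obtained serves to name the common size
   [k]. *)
have [i0 _] := fcover 0.
pose k := #|K i0 :\ 0|.
have sumK : (\sum_(i < n) #|K i :\ 0%R| = n * k)%N.
  rewrite -[n in RHS]card_ord -sum_nat_const; apply: eq_bigr => i _.
  apply: (@addIn 1); apply/eqP; rewrite -(@eqn_pmul2r #|A|) ?(ltnW A_gt1) //.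
  by rewrite cardKD -(cardKD i0).
move: leV; rewrite sumK -(cardKD i0) -/k mulnDl mul1n leq_subLR => leV.
(* At this point [leV] reads [k * #|A| + #|A| <= 1 + n * k], so [n <= #|A|] would force
   [#|A| <= 1]. *)
rewrite ltnNge; apply/negP => le_nA.
have := leq_trans leV (leq_add (leqnn 1) (leq_mul le_nA (leqnn k))).
by rewrite [(#|A| * k)%N]mulnC addnC leq_add2r leqNgt A_gt1.
Qed.

(** The naturals whose residues occur at coordinate [i] are closed under gcd by Bezout. They contain
    each [g j i], through unit vectors, and [N], which is 0 in ['Z_N]. *)
Lemma entry_is_col_gcd (N m n : nat) (g : 'M['Z_N]_(m, n)) (i : 'I_n) :
  (1 < N)%N -> exists u : 'rV_m, (u *m g) 0 i = (col_gcd g i)%:R.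
Proof.
move=> N_gt1; pose P k := exists u : 'rV_m, (u *m g) 0 i = k%:R.
have P0 : P 0%N by exists 0; rewrite mul0mx mxE.
have Pgcd a b : P a -> P b -> P (gcdn a b).
  (* Bezout over the naturals, [s * a = t * b + gcdn a b], is available for positive [a]. *)
  case: (posnP a) => [-> | a_gt0]; first by rewrite gcd0n.
  move=> [u] /[!mxE] ua [v] /[!mxE] vb; have [s t eq_st _] := egcdnP b a_gt0.
  exists (s%:R *: u - t%:R *: v); rewrite mulmxBl -!scalemxAl !mxE ua vb.
  by rewrite -!natrM eq_st natrD addrC addKr.
rewrite /col_gcd; apply: (Pgcd); last by exists 0; rewrite mul0mx mxE pchar_Zp.
apply: (big_ind P) => // j _.
by exists (delta_mx 0 j); rewrite -rowE mxE natr_Zp.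
Qed.

Lemma entry_onto_of_col_gcd1 (N m n : nat) (g : 'M['Z_N]_(m, n)) (i : 'I_n)
    (a : 'Z_N) :
  (1 < N)%N -> col_gcd g i = 1%N -> exists u : 'rV_m, (u *m g) 0 i = a.
Proof.
move=> N_gt1 gcd1; have [u] := @entry_is_col_gcd _ _ _ g i N_gt1; rewrite gcd1 => u1.
by exists (a *: u); rewrite -scalemxAl mxE u1 mulr1.
Qed.

(** A divisor of the prime [N] other than 1 is [N] itself, and a representative below [N] divisible
    by [N] is 0. Conversely a zero column has gcd [N], so it must be excluded. *)
Lemma col_gcd_prime (N m n : nat) (g : 'M['Z_N]_(m, n)) (i : 'I_n) :
  prime N -> col i g != 0 -> col_gcd g i = 1%N.
Proof.
move=> N_pr; have N_gt1 := prime_gt1 N_pr; apply: contra_neq_eq => gcd_neq1.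
have gcdN : col_gcd g i = N.
  have /primeP[_ /(_ (col_gcd g i))] := N_pr.
  by rewrite dvdn_gcdr (negPf gcd_neq1) => /(_ isT)/eqP.
apply/colP => j; rewrite !mxE; apply: val_inj => /=; apply/eqP.
have g_lt : (g j i < N)%N by rewrite -[N in (_ < N)%N]Zp_cast.
rewrite eqn0Ngt; apply/negP => g_gt0; move: g_lt; rewrite ltnNge => /negP[].
apply: dvdn_leq => //; rewrite -{1}gcdN.
by apply: dvdn_trans (dvdn_gcdl _ _) _; rewrite (bigD1 j) //= dvdn_gcdl.
Qed.

Theorem corollary2p13 (N d m : nat) (hN : (1 < N)%N)
    (C : {set 'rV['Z_N]_d.+1}) (hC : linear_code C) (hext : extended C)
    (g : 'M['Z_N]_(m, d.+1)) (hg : generating_matrix g C) (hthin : thin C) :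
  ((forall i : 'I_d.+1, col_gcd g i = 1%N) -> (N <= d)%N) /\
  (prime N -> (forall i : 'I_d.+1, col i g != 0) ->
     (forall i : 'I_d.+1, col_gcd g i = 1%N) /\ (N <= d)%N).
Proof.
have main : (forall i, col_gcd g i = 1%N) -> (N <= d)%N.
  move=> gcd1; have cardZ : #|'Z_N| = N by rewrite card_ord Zp_cast.
  rewrite -ltnS -[N in (N < _)%N]cardZ.
  (* Kernels are counted among coefficient vectors [u] instead of words, so [u *m g] may be
     many-to-one. *)
  apply: (@ltn_card_kernel_cover 'rV['Z_N]_m 'Z_N _ (fun i u => (u *m g) 0 i)).
  - by rewrite cardZ.
  - by move=> i u v; rewrite mulmxDl mxE.
  - by move=> i a; apply: entry_onto_of_col_gcd1.
  move=> u; case: hthin => _ no_word.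
  have [/existsP[i /eqP] | /existsPn nz] := boolP [exists i, (u *m g) 0 i == 0].
    by exists i.
  by case: no_word; exists (u *m g) => //; rewrite hg; apply: imset_f.
split=> // N_pr col_neq0.
have gcd1 i : col_gcd g i = 1%N by apply: col_gcd_prime.
by split=> //; apply: main.
Qed.
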